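(* Let $X=X_{a,b}$ be the Bourgain-Delbaen space with parameters $0<b<a<1$. For each $\epsilon>0$, $\eta(\epsilon,B_{X^*})<\omega$. Consequently, $C(\omega^\omega)$ is not isomorphic to a quotient of $X$.
   Context: All Banach spaces are real. $[\,\cdot\,]$ denotes closed linear span. $C(\omega^\omega)$ is the space of continuous functions on the ordinal interval $[1,\omega^\omega]$ with the order topology. $B_X$, $B_{X^*}$ are the closed unit balls of $X$, $X^*$. Construction of $X$. Fix real numbers $a,b>0$ and $\lambda>1$ with $b<a<1$ and $a+2b\lambda<\lambda$. Let $d_1=1$, $d_2=2$. Given $d_1,\dots,d_n$ ($n\ge 2$), let $d_{n+1}-d_n$ be the number of tuples $(\sigma',i,m,\sigma'',j)$ with $1\le m<n$, $1\le i\le d_m$, $1\le j\le d_n$, $\sigma',\sigma''\in\{1,-1\}$, and enumerate these tuples by the integers $k$ with $d_n<k\le d_{n+1}$; the tuple with index $k$ is called $\phi(k)$. This defines $\phi$ on $\mathbb N\setminus\{1,2\}$. In $\ell_\infty$ let $e_k$ be the $k$-th unit coordinate element, $e_k^*$ the $k$-th coordinate functional, $E_n=[e_k:k\le d_n]$, and $\pi_m:\ell_\infty\to E_m$ the standard coordinate projection. Define $i_{m,n}:E_m\to E_n$ for $m<n$ inductively: $i_{1,2}(te_1)=te_1$; if $i_{m,n}$ is defined for all $m<n$ (with $n\ge2$), put for $d_n<k\le d_{n+1}$ with $\phi(k)=(\sigma',i,m,\sigma'',j)$ $$f_{\phi(k)}(x)=a\sigma' e_i^*(x)+b\sigma'' e_j^*(x-i_{m,n}\pi_m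 x)\quad(x\in E_n),$$ $i_{n,n+1}(x)=x+\sum_{k=d_n+1}^{d_{n+1}}f_{\phi(k)}(x)e_k$ and $i_{m,n+1}=i_{n,n+1}\circ i_{m,n}$ for $m<n$. It is known that $\|i_{m,n}\|\le\lambda$ for all $m<n$; $P_m:\ell_\infty\to\ell_\infty$ is the coordinatewise limit of $i_{m,n}\pi_m$ as $n\to\infty$ (each coordinate is eventually constant in $n$). Finally $X=X_{a,b}=[P_m(E_m):m\in\mathbb N]\subset\ell_\infty$. Szlenk index. For a Banach space $X$, $B\subset X^*$ and $\epsilon>0$ let $P_0(\epsilon,B)=B$; let $P_{\alpha+1}(\epsilon,B)$ be the set of $b\in B$ for which there exist $(a_n)\subset B_X$ and $(b_n)\subset P_\alpha(\epsilon,B)$ with $\mathrm{w}^*\text{-}\lim b_n=b$, $\lim b_n(a_n)\ge\epsilon$ and $\mathrm{w}\text{-}\lim a_n=0$; and $P_\alpha(\epsilon,B)=\bigcap_{\beta<\alpha}P_\beta(\epsilon,B)$ for limit $\alpha$. Then $\eta(\epsilon,B)$ is the smallest ordinal $\alpha$ with $P_\alpha(\epsilon,B)=\emptyset$ (and $\omega_1$ if there is no such countable $\alpha$). *)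

(* Defs.v *)
From HB Require Import structures.
From mathcomp Require Import all_boot all_order all_algebra.
From mathcomp Require Import all_classical all_reals all_analysis.
From mathcomp Require Import wochoice.

Set Implicit Arguments.
Unset Strict Implicit.
Unset Printing Implicit Defensive.

Import Order.TTheory GRing.Theory Num.Theory.
Import numFieldNormedType.Exports.

Local Open Scope classical_set_scope.
Local Open Scope ring_scope.

Record linSubspace (R : realType) (V : normedModType R) := LinSubspace {
  subspace_pred :> {pred V};
  subspace_submod : submod_closed subspace_pred }.

HB.instance Definition _ (R : realType) (V : normedModType R)
    (Y : linSubspace V) :=
  GRing.isSubmodClosed.Build R V (subspace_pred Y) (@subspace_submod R V Y).

Section SubspaceType.
Variables (R : realType) (V : normedModType R) (Y : linSubspace V).

Definition subspace_type := {x : V | x \in subspace_pred Y}.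

HB.instance Definition _ := SubChoice.on subspace_type.
HB.instance Definition _ := [SubChoice_isSubLmodule of subspace_type by <:].

Definition subspace_norm (x : subspace_type) : R := `|\val x|.

Let subspace_ler_normD x y :
  subspace_norm (x + y) <= subspace_norm x + subspace_norm y.
Proof. by rewrite /subspace_norm raddfD ler_normD. Qed.

Let subspace_normrZ (l : R) x : subspace_norm (l *: x) = `|l| * subspace_norm x.
Proof. by rewrite /subspace_norm linearZ normrZ. Qed.

Let subspace_normr0 x : subspace_norm x = 0 -> x = 0.
Proof. by move=> /normr0_eq0 x0; apply: val_inj; rewrite x0 raddf0. Qed.

HB.instance Definition _ := Lmodule_isNormed.Build R subspace_type
  subspace_ler_normD subspace_normrZ subspace_normr0.
End SubspaceType.

Record closedSubspace (R : realType) (V : normedModType R) := ClosedSubspace {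
  closed_subspace :> linSubspace V;
  closed_subspaceP : closed [set` subspace_pred closed_subspace] }.

Section QuotientType.
Variables (R : realType) (V : normedModType R) (Y : closedSubspace V).
Local Open Scope quotient_scope.

Definition quotient_type := Quotient.quot (subspace_pred Y).

HB.instance Definition _ := GRing.Zmodule.on quotient_type.

Definition quotient_pi (x : V) : quotient_type := \pi_(quotient_type) x.

Lemma quotient_piD : {morph quotient_pi : x y / x + y}.
Proof. by move=> x y; rewrite /quotient_pi !piE. Qed.

Lemma quotient_pi_eq x y :
  (quotient_pi x = quotient_pi y) <-> (x - y \in subspace_pred Y).
Proof. by rewrite Quotient.idealrBE; split => /eqP. Qed.

Definition quotient_scale (l : R) (q : quotient_type) : quotient_type :=
  quotient_pi (l *: repr q).

Lemma quotient_piZ l x : quotient_pi (l *: x) = quotient_scale l (quotient_pi x).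
Proof.
apply/quotient_pi_eq; rewrite -scalerBr rpredZ//.
by apply/quotient_pi_eq; rewrite /quotient_pi reprK.
Qed.

Lemma quotient_piK q : quotient_pi (repr q) = q.
Proof. exact: reprK. Qed.

Fact quotient_scalerA l m q :
  quotient_scale l (quotient_scale m q) = quotient_scale (l * m) q.
Proof. by rewrite -(quotient_piK q) -!quotient_piZ scalerA. Qed.

Fact quotient_scale1r : left_id 1 quotient_scale.
Proof. by move=> q; rewrite -(quotient_piK q) -!quotient_piZ scale1r. Qed.

Fact quotient_scalerDr : right_distributive quotient_scale +%R.
Proof.
move=> l p q; rewrite -(quotient_piK p) -(quotient_piK q).
by rewrite -quotient_piD -!quotient_piZ scalerDr quotient_piD.
Qed.

Fact quotient_scalerDl q : {morph quotient_scale^~ q : l m / l + m}.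
Proof.
move=> l m; rewrite -(quotient_piK q).
by rewrite -!quotient_piZ scalerDl quotient_piD.
Qed.

HB.instance Definition _ := GRing.Zmodule_isLmodule.Build R quotient_type
  quotient_scalerA quotient_scale1r quotient_scalerDr quotient_scalerDl.

Definition quotient_norm (q : quotient_type) : R :=
  inf [set `|x| | x in [set x | quotient_pi x = q]].

Lemma quotient_norm_has_inf q :
  has_inf [set `|x| | x in [set x | quotient_pi x = q]].
Proof.
split; first by exists `|repr q|, (repr q); rewrite //= quotient_piK.
by exists 0 => _ [x _ <-].
Qed.

Lemma quotient_norm_le x : quotient_norm (quotient_pi x) <= `|x|.
Proof.
by apply: ge_inf; [case: (quotient_norm_has_inf (quotient_pi x))|exists x].
Qed.

Lemma quotient_norm_lt q e : quotient_norm q < e ->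
  exists2 x, quotient_pi x = q & `|x| < e.
Proof.
move=> /(inf_lt (quotient_norm_has_inf q).1)[_ [x xq <-] xe].
by exists x.
Qed.

Lemma quotient_norm_ge0 q : 0 <= quotient_norm q.
Proof.
by apply: lb_le_inf; [exact: (quotient_norm_has_inf q).1|move=> _ [x _ <-]].
Qed.

Fact quotient_ler_normD p q :
  quotient_norm (p + q) <= quotient_norm p + quotient_norm q.
Proof.
apply/ler_addgt0Pr => e e0.
have e2 : 0 < e / 2 by rewrite divr_gt0.
have [|x xp xlt] := @quotient_norm_lt p (quotient_norm p + e / 2).
  by rewrite ltrDl.
have [|y yq ylt] := @quotient_norm_lt q (quotient_norm q + e / 2).
  by rewrite ltrDl.
rewrite -xp -yq -quotient_piD (le_trans (quotient_norm_le _))//.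
rewrite (le_trans (ler_normD _ _))// xp yq (splitr e) addrACA.
by rewrite lerD// ltW.
Qed.

Let quotient_normZ_le (l : R) q :
  quotient_norm (l *: q) <= `|l| * quotient_norm q.
Proof.
apply/ler_addgt0Pr => e e0.
have l1 : 0 < `|l| + 1 by rewrite ltr_wpDl.
have [|x xq xlt] := @quotient_norm_lt q (quotient_norm q + e / (`|l| + 1)).
  by rewrite ltrDl divr_gt0.
rewrite -{1}xq -[l *: _]quotient_piZ (le_trans (quotient_norm_le _))//.
rewrite normrZ (le_trans (ler_wpM2l _ (ltW xlt)))// mulrDr lerD2l.
by rewrite mulrCA ler_piMr ?(ltW e0)// ler_pdivrMr// mul1r lerDl.
Qed.

Fact quotient_normrZ (l : R) q :
  quotient_norm (l *: q) = `|l| * quotient_norm q.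
Proof.
apply/eqP; rewrite eq_le quotient_normZ_le /=.
have [->|l0] := eqVneq l 0; first by rewrite normr0 mul0r quotient_norm_ge0.
rewrite mulrC -ler_pdivlMr ?normr_gt0// mulrC -normfV.
by rewrite (le_trans _ (quotient_normZ_le _ _))// scalerA mulVf// scale1r.
Qed.

Fact quotient_normr0 q : quotient_norm q = 0 -> q = 0.
Proof.
move=> q0; have -> : 0 = quotient_pi 0 by rewrite /quotient_pi !piE.
rewrite -(quotient_piK q); apply/quotient_pi_eq; rewrite subr0.
have := @closed_subspaceP R V Y; rewrite closure_id => YE.
suff : closure [set` subspace_pred Y] (repr q) by rewrite -YE.
move=> B /nbhs_ballP[e /= e0 eB].
have [|x xq xe] := @quotient_norm_lt q e; first by rewrite q0.
exists (repr q - x); split.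
  by apply/quotient_pi_eq; rewrite quotient_piK.
by apply: eB; rewrite -ball_normE /= opprB addrC subrK.
Qed.

HB.instance Definition _ := Lmodule_isNormed.Build R quotient_type
  quotient_ler_normD quotient_normrZ quotient_normr0.
End QuotientType.

Definition isomorphic (R : realType) (V W : normedModType R) : Prop :=
  exists (f : {linear V -> W}) (g : {linear W -> V}),
    [/\ continuous f, continuous g, cancel f g & cancel g f].

Definition isomorphic_to_quotient (R : realType) (W V : normedModType R) :=
  exists Y : closedSubspace V, isomorphic W (quotient_type Y).

Section ClosedSpan.
Variables (R : realType) (V : normedModType R) (A : set V).

Definition linear_span : set V :=
  [set v | exists n (c : 'I_n -> R) (u : 'I_n -> V),
     (forall i, A (u i)) /\ v = \sum_(i < n) c i *: u i].

Definition closed_span_pred : {pred V} :=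
  fun v => `[< closure linear_span v >].

Lemma linear_span0 : linear_span 0.
Proof.
by exists 0%N, (fun=> 0), (fun=> 0); split=> [[]//|]; rewrite big_ord0.
Qed.

Lemma linear_spanP (k : R) u v :
  linear_span u -> linear_span v -> linear_span (k *: u + v).
Proof.
move=> [m [c [x [Ax ->]]]] [n [d [y [Ay ->]]]].
exists (m + n)%N, (fun i => match fintype.split i with
  inl j => k * c j | inr j => d j end), (fun i => match fintype.split i with
  inl j => x j | inr j => y j end); split.
  by move=> i; case: (fintype.split i).
rewrite big_split_ord /= scaler_sumr; congr (_ + _); apply: eq_bigr => i _.
  by rewrite -[lshift _ _]/(unsplit (inl i)) unsplitK scalerA.
by rewrite -[rshift _ _]/(unsplit (inr i)) unsplitK.
Qed.

Lemma closed_span_submod : submod_closed closed_span_pred.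
Proof.
split; first by apply/asboolP/subset_closure/linear_span0.
move=> k u v /asboolP Su /asboolP Sv; apply/asboolP => B Bkuv.
have /= [[P Q] [/= Pu Qv] PQ] : nbhs (u, v) [set w : V * V | B (k *: w.1 + w.2)].
  have : {for (u, v), continuous (fun w : V * V => k *: w.1 + w.2)}.
    apply: continuousD; last exact: cvg_snd.
    by apply: continuousZl_tmp; exact: cvg_fst.
  by move=> /(_ B Bkuv).
have [x [Sx Px]] := Su _ Pu; have [y [Sy Qy]] := Sv _ Qv.
by exists (k *: x + y); split; [exact: linear_spanP|exact: (PQ (x, y))].
Qed.

Definition closed_span : linSubspace V := LinSubspace closed_span_submod.
End ClosedSpan.

Section BoundedFunctions.
Variables (R : realType) (T : Type).

Definition bounded_pred : {pred T -> R^o} := fun f => `[< bounded_fun f >].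

Lemma bounded_predP (f : T -> R^o) :
  reflect (exists M, forall t, `|f t| <= M) (f \in bounded_pred).
Proof.
rewrite unfold_in /bounded_pred.
apply: (iffP (@asboolP (bounded_fun f))) => bf.
  have [M [_ fM]] := bf; exists (M + 1) => t.
  by apply: fM => //; rewrite ltrDl.
have [M fM] := bf; exists M; split; first exact: num_real.
by move=> x /ltW Mx t _; exact: le_trans (fM t) Mx.
Qed.

Lemma bounded_submod : submod_closed bounded_pred.
Proof.
split; first by apply/bounded_predP; exists 0 => t; rewrite normr0.
move=> k f g /bounded_predP[M fM] /bounded_predP[N gN].
apply/bounded_predP; exists (`|k| * M + N) => t.
by rewrite (le_trans (ler_normD _ _))// lerD// normrM ler_wpM2l.
Qed.

HB.instance Definition _ :=
  GRing.isSubmodClosed.Build R (T -> R^o) bounded_pred bounded_submod.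

Definition bfun := {f : T -> R^o | f \in bounded_pred}.

HB.instance Definition _ := SubChoice.on bfun.
HB.instance Definition _ := [SubChoice_isSubLmodule of bfun by <:].

Lemma bfunD (f g : bfun) : \val (f + g) = \val f + \val g.
Proof. by rewrite raddfD. Qed.

Lemma bfunZ (l : R) (f : bfun) : \val (l *: f) = l *: \val f.
Proof. by rewrite linearZ. Qed.

Definition bfun_norm (f : bfun) : R := sup [set `|\val f t| | t in [set: T]].

Lemma bfun_norm_ge (f : bfun) t : `|\val f t| <= bfun_norm f.
Proof.
have /bounded_predP[M fM] := valP f.
by apply: ub_le_sup; [exists M => _ [s _ <-]|exists t].
Qed.

Lemma bfun_norm_le (f : bfun) M :
  0 <= M -> (forall t, `|\val f t| <= M) -> bfun_norm f <= M.
Proof.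
move=> M0 fM; rewrite /bfun_norm.
have [->|/set0P S0] := eqVneq [set `|\val f t| | t in [set: T]] set0.
  by rewrite sup0.
by apply: ge_sup => // _ [t _ <-].
Qed.

Lemma bfun_norm_ge0 (f : bfun) : 0 <= bfun_norm f.
Proof.
rewrite /bfun_norm.
have [->|/set0P[_ [t _ _]]] := eqVneq [set `|\val f t| | t in [set: T]] set0.
  by rewrite sup0.
exact: le_trans (bfun_norm_ge f t).
Qed.

Let bfun_ler_normD f g : bfun_norm (f + g) <= bfun_norm f + bfun_norm g.
Proof.
apply: bfun_norm_le => [|t]; first by rewrite addr_ge0 ?bfun_norm_ge0.
by rewrite raddfD (le_trans (ler_normD _ _))// lerD// bfun_norm_ge.
Qed.

Let bfun_normZ_le (l : R) f : bfun_norm (l *: f) <= `|l| * bfun_norm f.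
Proof.
apply: bfun_norm_le => [|t]; first by rewrite mulr_ge0 ?bfun_norm_ge0.
by rewrite linearZ normrM ler_wpM2l// bfun_norm_ge.
Qed.

Let bfun_normrZ (l : R) f : bfun_norm (l *: f) = `|l| * bfun_norm f.
Proof.
apply/eqP; rewrite eq_le bfun_normZ_le /=.
have [->|l0] := eqVneq l 0; first by rewrite normr0 mul0r bfun_norm_ge0.
rewrite mulrC -ler_pdivlMr ?normr_gt0// mulrC -normfV.
by rewrite (le_trans _ (bfun_normZ_le _ _))// scalerA mulVf// scale1r.
Qed.

Let bfun_normr0 f : bfun_norm f = 0 -> f = 0.
Proof.
move=> f0; apply: val_inj; apply/funext => t; apply/eqP.
by rewrite -normr_le0 -f0 bfun_norm_ge.
Qed.

HB.instance Definition _ := Lmodule_isNormed.Build R bfun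
  bfun_ler_normD bfun_normrZ bfun_normr0.
End BoundedFunctions.

Section ContinuousFunctions.
Variables (R : realType) (K : topologicalType).

Definition continuous_pred : {pred bfun R K} :=
  fun f => `[< continuous (\val f) >].

Lemma continuous_submod : submod_closed continuous_pred.
Proof.
split; first by apply/asboolP => x; exact: cst_continuous.
move=> k f g /asboolP fc /asboolP gc; apply/asboolP => x.
have -> : \val (k *: f + g) = (fun t => k *: \val f t + \val g t) :> (K -> R^o).
  by rewrite bfunD bfunZ.
by apply: cvgD; [apply: cvgZl_tmp; exact: fc|exact: gc].
Qed.

(* For compact K boundedness is automatic and this is C(K). *)
Definition continuous_functions := subspace_type (LinSubspace continuous_submod).

HB.instance Definition _ := NormedModule.on continuous_functions.
End ContinuousFunctions.

(* The ordinal w^n c_0 + w^(n-1) c_1 + ... + c_n with c_0 > 0 (zero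
   coefficients allowed after c_0) is [Some [:: c_0; ...; c_n]]; these are
   exactly the ordinals in [1, w^w[, and [None] is w^w. *)
Definition omega_omega_itv := option {s : seq nat | head 0%N s != 0%N}.

HB.instance Definition _ := Choice.on omega_omega_itv.

Definition cnf_le (s t : seq nat) :=
  (size s < size t)%N ||
  ((size s == size t) && ((s : seqlexi nat) <= (t : seqlexi nat))%O).

Definition omega_omega_le (x y : omega_omega_itv) : bool :=
  match x, y with
  | _, None => true
  | None, Some _ => false
  | Some s, Some t => cnf_le (\val s) (\val t)
  end.

Lemma cnf_le_anti : antisymmetric cnf_le.
Proof.
move=> s t; rewrite /cnf_le (eq_sym (size t)).
by case: ltngtP => //= _ /andP[st ts]; apply/(@le_anti _ (seqlexi nat))/andP.
Qed.

Lemma cnf_le_trans : transitive cnf_le.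
Proof.
move=> t s u; rewrite /cnf_le => /orP[st|/andP[/eqP -> st]] /orP[tu|/andP[/eqP e tu]].
- by rewrite (ltn_trans st tu).
- by rewrite -e st.
- by rewrite tu.
- by rewrite e eqxx (le_trans st tu) orbT.
Qed.

Lemma cnf_le_total : total cnf_le.
Proof.
by move=> s t; rewrite /cnf_le (eq_sym (size t)); case: ltngtP => //= _; exact: le_total.
Qed.

Fact omega_omega_le_anti : antisymmetric omega_omega_le.
Proof.
by move=> [s|] [t|] //= /cnf_le_anti/val_inj->.
Qed.

Fact omega_omega_le_trans : transitive omega_omega_le.
Proof. by move=> [t|] [s|] [u|] //=; exact: cnf_le_trans. Qed.

Fact omega_omega_le_total : total omega_omega_le.
Proof. by move=> [s|] [t|] //=; exact: cnf_le_total. Qed.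

Fact omega_omega_display : Order.disp_t. Proof. by []. Qed.

HB.instance Definition _ := Order.isOrder.Build omega_omega_display
  omega_omega_itv (fun _ _ => erefl) (fun _ _ => erefl) (fun _ _ => erefl)
  omega_omega_le_anti omega_omega_le_trans omega_omega_le_total.

Definition C_omega_omega (R : realType) : normedModType R :=
  continuous_functions R (order_topology omega_omega_itv).

Definition cantor_wo : rel (nat -> bool) :=
  sval (well_ordering_principle (nat -> bool)).

Lemma cantor_woP : well_order cantor_wo.
Proof. exact: svalP (well_ordering_principle (nat -> bool)). Qed.

(* The points of a well-ordered uncountable set with only countably many
   predecessors form a well-ordered set of order type the first uncountable
   ordinal, i.e. the set of all countable ordinals. *)
Definition omega1_pred : {pred nat -> bool} :=
  fun x => `[< countable [set y | cantor_wo y x] >].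

Definition omega1 := {x : nat -> bool | x \in omega1_pred}.

HB.instance Definition _ := Choice.on omega1.

Definition omega1_le (x y : omega1) : bool := cantor_wo (\val x) (\val y).

Fact cantor_wo_chain : wo_chain cantor_wo predT.
Proof. by move=> A _; exact: cantor_woP. Qed.

Fact omega1_le_anti : antisymmetric omega1_le.
Proof.
move=> x y xy; apply: val_inj.
exact: (wo_chain_antisymmetric cantor_wo_chain).
Qed.

Fact cantor_wo_trans : transitive cantor_wo.
Proof.
move=> y x z xy yz.
have [|m [[mS mlb] _]] := @cantor_woP (mem [:: x; y; z]).
  by exists x; rewrite inE eqxx.
have mx : cantor_wo m x by apply: mlb; rewrite !inE eqxx.
have my : cantor_wo m y by apply: mlb; rewrite !inE eqxx orbT.
have mz : cantor_wo m z by apply: mlb; rewrite !inE eqxx !orbT.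
have anti := wo_chain_antisymmetric cantor_wo_chain.
move: mS; rewrite !inE => /or3P[]/eqP e; first by rewrite -e.
  have -> // : x = y by apply: anti => //; rewrite xy -e mx.
by have <- // : y = z by apply: anti => //; rewrite yz -e my.
Qed.

Fact omega1_le_trans : transitive omega1_le.
Proof. by move=> y x z; exact: cantor_wo_trans. Qed.

Fact omega1_le_total : total omega1_le.
Proof. by move=> x y; exact: (wo_chainW cantor_wo_chain). Qed.

Fact omega1_display : Order.disp_t. Proof. by []. Qed.

HB.instance Definition _ := Order.isOrder.Build omega1_display
  omega1 (fun _ _ => erefl) (fun _ _ => erefl) (fun _ _ => erefl)
  omega1_le_anti omega1_le_trans omega1_le_total.

Lemma omega1_well_ordered (S : set omega1) :
  S !=set0 -> exists2 x, S x & forall y, S y -> (x <= y)%O.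
Proof.
move=> [s Ss].
have [|m [[/asboolP[x Sx xm] mlb] _]] :=
    @cantor_woP (fun z => `[< exists2 x, S x & \val x = z >]).
  by exists (\val s); apply/asboolP; exists s.
exists x => // y Sy; have : cantor_wo m (\val y).
  by apply: mlb; apply/asboolP; exists y.
by rewrite -xm.
Qed.

Lemma omega1_countable (x : omega1) : countable [set y : omega1 | (y <= x)%O].
Proof.
have /asboolP/countable_injP[f fi] := valP x.
apply/countable_injP; exists (f \o \val) => y z /set_mem yx /set_mem zx fyz.
by apply: val_inj; apply: fi => //; rewrite inE.
Qed.

Lemma omega1_uncountable : ~ countable [set: omega1].
Proof.
move=> omega1c.
have Pc : countable [set z | z \in omega1_pred].
  rewrite (_ : [set z | _] = (val : omega1 -> _) @` setT).
    exact: sub_countable (card_image_le _ _) omega1c.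
  apply/seteqP; split => [z /= zP|_ [x _ <-]]; last exact: valP.
  by exists (Sub z zP); rewrite ?SubK.
have PT z : z \in omega1_pred.
  apply: contrapT => Nz.
  have [|m [[/negP mN mlb] _]] := @cantor_woP (fun z => z \notin omega1_pred).
    by exists z; apply/negP.
  apply: mN; apply/asboolP.
  pose F b : set (nat -> bool) := if b then [set z | z \in omega1_pred] else [set m].
  have Fc : countable (\bigcup_b F b).
    by apply: bigcup_countable => // -[] _; [exact: Pc|exact: countable1].
  apply: sub_countable Fc; apply: subset_card_le => y /= ym.
  have [yP|yN] := boolP (y \in omega1_pred); first by exists true.
  exists false => //=; apply: (wo_chain_antisymmetric cantor_wo_chain) => //.
  by rewrite ym; exact: mlb.
have /countable_injP[f fi] := Pc.
pose D n := `[< exists2 z, f z = n & ~~ z n >].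
have [|Dn] := boolP (D (f D)); last first.
  by move/asboolP: (Dn); apply; exists D.
move=> DfD; have /asboolP[z zD] := DfD.
have -> : z = D by apply: fi => //; rewrite inE /= PT.
by rewrite DfD.
Qed.

Definition ord_zero (al : omega1) := forall be : omega1, (al <= be)%O.

Definition ord_succ (be al : omega1) :=
  (be < al)%O /\ forall ga : omega1, (be < ga)%O -> (al <= ga)%O.

Definition ord_limit (al : omega1) :=
  ~ ord_zero al /\ forall be, ~ ord_succ be al.

Record dual (R : realType) (V : normedModType R) := Dual {
  dual_fun :> {linear V -> R^o};
  dual_continuous : continuous dual_fun }.

Section Szlenk.
Variables (R : realType) (V : normedModType R).

Definition unit_ball : set V := [set x | `|x| <= 1].

Definition dual_norm (f : dual V) : R := sup [set `|f x| | x in unit_ball].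

Definition dual_ball : set (dual V) := [set f | dual_norm f <= 1].

Definition weakly_null (x : nat -> V) :=
  forall h : dual V, h (x n) @[n --> \oo] --> (0 : R).

Definition weak_star_cvg (g : nat -> dual V) (f : dual V) :=
  forall x : V, g n x @[n --> \oo] --> f x.

Definition szlenk_derived (eps : R) (B P : set (dual V)) : set (dual V) :=
  [set f | B f /\ exists (x : nat -> V) (g : nat -> dual V) (l : R),
    [/\ forall n, unit_ball (x n) /\ P (g n),
        weak_star_cvg g f,
        g n (x n) @[n --> \oo] --> l,
        eps <= l
      & weakly_null x]].

(* The transfinite recursion on al; since every al < omega_1 is of exactly one
   of the three kinds and < is well-founded, the inductive predicate is the
   unique solution of the recursion equations. *)
Inductive szlenk_set (eps : R) (B : set (dual V)) : omega1 -> set (dual V) :=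
| szlenk_set_zero al f : ord_zero al -> B f -> szlenk_set eps B al f
| szlenk_set_succ be al f : ord_succ be al ->
    szlenk_derived eps B (szlenk_set eps B be) f -> szlenk_set eps B al f
| szlenk_set_limit al f : ord_limit al ->
    (forall be : omega1, (be < al)%O -> szlenk_set eps B be f) ->
    szlenk_set eps B al f.

Definition szlenk_dies (eps : R) (B : set (dual V)) : set omega1 :=
  [set al | szlenk_set eps B al = set0].

(* Values are ordinals <= omega_1, with [None] for omega_1. *)
Definition szlenk_eta (eps : R) (B : set (dual V)) : option omega1 :=
  if pselect (exists al, szlenk_dies eps B al /\
                forall be, szlenk_dies eps B be -> (al <= be)%O) is left ex
  then Some (projT1 (cid ex)) else None.
End Szlenk.

(* An ordinal is < omega iff it has finitely many predecessors. *)
Definition lt_omega (al : option omega1) : Prop :=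
  if al is Some be then finite_set [set ga : omega1 | (ga < be)%O] else False.

(* Coordinates are numbered from 0: the k-th coordinate of a vector is the
   (k+1)-st one of the usual presentation, so that E_n is spanned by the e_k
   with k < d n, and the ranges of i, j, k below are shifted accordingly.
   Stages m, n are numbered from 1; the value d 0 is irrelevant. *)

Record bd_tuple := BDTuple {
  bd_s1 : bool; bd_i : nat; bd_m : nat; bd_s2 : bool; bd_j : nat }.

Definition bd_tuples (d : nat -> nat) (n : nat) : set bd_tuple :=
  [set t | [/\ (1 <= bd_m t < n)%N, (bd_i t < d (bd_m t))%N
             & (bd_j t < d n)%N]].

Definition bd_enumeration (d : nat -> nat) (phi : nat -> bd_tuple) : Prop :=
  [/\ d 1%N = 1%N, d 2%N = 2%N &
      forall n, (2 <= n)%N ->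
        [/\ (d n <= d n.+1)%N,
            (bd_tuples d n #= `I_(d n.+1 - d n))%card
          & set_bij [set k | (d n <= k < d n.+1)%N] (bd_tuples d n) phi]].

Section BourgainDelbaen.
Variables (R : realType) (a b : R) (d : nat -> nat) (phi : nat -> bd_tuple).

Local Notation ell_inf := (bfun R nat).

Definition bd_proj (m : nat) (x : nat -> R) : nat -> R :=
  fun k => if (k < d m)%N then x k else 0.

(* [bd_ext m n] is i_{m,n}, with i_{m,n} = id when n <= m; a sign s is encoded
   by a boolean as (-1) ^+ s. *)
Fixpoint bd_ext (m n : nat) (x : nat -> R) {struct n} : nat -> R :=
  if n is n'.+1 then
    if (m <= n')%N then
      let y := bd_ext m n' x in
      fun k => y k +
        if (2 <= n')%N && (d n' <= k < d n'.+1)%N then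
          let: BDTuple s1 i p s2 j := phi k in
          a * (-1) ^+ s1 * y i +
          b * (-1) ^+ s2 * (y j - bd_ext p n' (bd_proj p y) j)
        else 0
    else x
  else x.

Definition bd_P (m : nat) (x : nat -> R) : nat -> R :=
  fun k => limn (fun n => bd_ext m n (bd_proj m x) k : R^o).

Lemma ell_unit_bounded (k : nat) :
  (fun l => (l == k)%:R : R^o) \in @bounded_pred R nat.
Proof.
by apply/bounded_predP; exists 1 => l; case: eqP; rewrite ?normr1 ?normr0.
Qed.

Definition ell_unit (k : nat) : ell_inf :=
  exist (fun x => x \in bounded_pred (T:=nat)) _ (ell_unit_bounded k).

Definition bd_E (n : nat) : linSubspace ell_inf :=
  closed_span [set ell_unit k | k in `I_(d n)].

(* P_m x is a bounded sequence since ||i_{m,n}|| <= lambda. *)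
Definition bd_generators : set ell_inf :=
  [set v | exists m x, [/\ (1 <= m)%N, x \in subspace_pred (bd_E m)
                         & \val v = bd_P m (\val x)]].

Definition bd_space : normedModType R :=
  subspace_type (closed_span bd_generators).
End BourgainDelbaen.

(* Main.v *)
(* A coordinate functional of the space equals, up to a defect seen by one block
   only, a times a coordinate of an initial part plus b times a coordinate of
   the remaining part. As b < a < 1, unrolling this identity t times bounds a sum
   of n successive blocks of norm at most C by a^t C n + K_t, which is o(n). A
   functional surviving n Szlenk derivations yields n almost successive blocks
   on which some functional of the dual ball exceeds eps / 2, so n is bounded.

   The same estimate excludes quotients directly, with no lifting of weakly null
   sequences: an interval of type w^(r+1) contains infinitely many disjoint
   intervals of type w^r; lift their indicators to bounded vectors and, by the
   pigeonhole principle, take the difference of two lifts which almost agree on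
   a given finite set of coordinates. Iterating n times gives n almost successive
   blocks whose images all take the value 1 at a common point. *)

From HB Require Import structures.
Require Import Defs.
From mathcomp Require Import all_boot all_order all_algebra.
From mathcomp Require Import all_classical all_reals all_analysis.
From mathcomp Require Import zify ring lra.

Set Implicit Arguments.
Unset Strict Implicit.
Unset Printing Implicit Defensive.

Import Order.TTheory GRing.Theory Num.Theory.
Import numFieldNormedType.Exports.

Local Open Scope classical_set_scope.
Local Open Scope ring_scope.

(** * Coordinate projections and sums of blocks *)

Section Projections.
Variables (R : realType) (a b : R) (d : nat -> nat) (phi : nat -> bd_tuple).
Hypothesis hphi : bd_enumeration d phi.

Lemma bd_phi_range n k : (2 <= n)%N -> (d n <= k < d n.+1)%N ->
  [/\ (1 <= bd_m (phi k) < n)%N, (bd_i (phi k) < d (bd_m (phi k)))%N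
    & (bd_j (phi k) < d n)%N].
Proof.
have [_ _ +] := hphi => /[apply] -[_ _ [phi_fun _ _]] kn.
exact: (phi_fun k kn).
Qed.

Lemma bd_dim_lt n : (1 <= n)%N -> (d n < d n.+1)%N.
Proof.
have [d1 d2 dS] := hphi; rewrite leq_eqVlt => /orP[/eqP <-|n2].
  by rewrite d1 d2.
have [dn _ [_ _ phi_surj]] := dS n n2.
have dn0 : (0 < d n)%N.
  elim: n n2 dn {phi_surj} => // n IH; rewrite leq_eqVlt => /orP[/eqP <-|].
    by rewrite d2.
  rewrite ltnS => n2 _; have [dn _ _] := dS n n2.
  by rewrite (leq_trans (IH n2 dn)).
(* This tuple is admissible at every stage n >= 2, so each such stage creates a new coordinate. *)
have [|k /= /andP[nk kn] _] := phi_surj (BDTuple true 0 1 true 0).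
  by split; rewrite /= ?d1.
exact: leq_ltn_trans kn.
Qed.

Lemma bd_dim_le m n : (1 <= m)%N -> (m <= n)%N -> (d m <= d n)%N.
Proof.
move=> m1; elim: n => [|n IH]; first by lia.
rewrite leq_eqVlt => /orP[/eqP-> //|]; rewrite ltnS => mn.
by rewrite (leq_trans (IH mn))// ltnW// bd_dim_lt//; lia.
Qed.

Lemma bd_dim_ge n : (1 <= n)%N -> (n <= d n)%N.
Proof.
elim: n => [//|[|n] IH _]; first by have [-> _ _] := hphi.
exact: leq_ltn_trans (IH isT) (bd_dim_lt _).
Qed.

Lemma bd_stage k : (2 <= k)%N -> exists2 n, (2 <= n)%N & (d n <= k < d n.+1)%N.
Proof.
have [_ d2 _] := hphi => k2.
suff H n : (k < d n.+1)%N -> exists2 n, (2 <= n)%N & (d n <= k < d n.+1)%N.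
  exact/(H k)/bd_dim_ge.
elim: n => [|n IH]; first by case: hphi => -> _ _; lia.
have [kn _|nk kn] := ltnP k (d n.+1); first exact: IH.
 exists n.+1; last by rewrite nk kn.
by case: n {IH} nk kn => // _; rewrite d2; lia.
Qed.

Lemma bd_ext_ge m n (x : nat -> R) : (n <= m)%N -> bd_ext a b d phi m n x = x.
Proof. by case: n => // n nm; rewrite /= leqNgt nm. Qed.

(** Passing from stage n to n + 1 alters only coordinates from [d n] on. Hence the limit in [bd_P]
    is attained once [d n] exceeds k, which is [bd_PE]. *)
Lemma bd_ext_stable m n n' (x : nat -> R) k : (1 <= n)%N -> (n <= n')%N ->
  (k < d n)%N -> bd_ext a b d phi m n' x k = bd_ext a b d phi m n x k.
Proof.
move=> n1; elim: n' => [|n' IH]; first by lia.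
rewrite leq_eqVlt => /orP[/eqP-> //|]; rewrite ltnS => nn' kn.
rewrite -IH//=; case: (leqP m n') => [_|n'm]; last by rewrite bd_ext_ge ?(ltnW n'm).
by rewrite [(d n' <= k)%N]leqNgt (leq_trans kn (bd_dim_le n1 nn')) andbF addr0.
Qed.

Lemma bd_ext_support m n (x : nat -> R) k : (1 <= m)%N -> (m <= n)%N ->
  (d n <= k)%N -> bd_ext a b d phi m n (bd_proj d m x) k = 0.
Proof.
move=> m1; elim: n k => [|n IH] k; first by lia.
rewrite leq_eqVlt => /orP[/eqP<- mk|].
  by rewrite bd_ext_ge// /bd_proj ltnNge mk.
rewrite ltnS => mn nk /=; rewrite mn IH//; last first.
  by rewrite (leq_trans _ nk)// ltnW// bd_dim_lt// (leq_trans m1).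
by rewrite [(k < _)%N]ltnNge nk /= !andbF addr0.
Qed.

Lemma bd_PE m n (x : nat -> R) k : (1 <= n)%N -> (k < d n)%N ->
  bd_P a b d phi m x k = bd_ext a b d phi m n (bd_proj d m x) k.
Proof.
move=> n1 kn; apply: norm_cvg_lim; apply: cvg_near_cst.
exists n => // n' /= nn'; exact: bd_ext_stable.
Qed.

Lemma bd_P_local m (x y : nat -> R) : (forall k, (k < d m)%N -> x k = y k) ->
  bd_P a b d phi m x = bd_P a b d phi m y.
Proof.
move=> xy; rewrite /bd_P; suff -> : bd_proj d m x = bd_proj d m y by [].
by apply/funext => k; rewrite /bd_proj; case: ifP => // /xy.
Qed.

Lemma bd_P_init m (x : nat -> R) k : (1 <= m)%N -> (k < d m)%N ->
  bd_P a b d phi m x k = x k.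
Proof. by move=> m1 km; rewrite (@bd_PE m m)// bd_ext_ge// /bd_proj km. Qed.

(* The functional f_{phi(k)}, with [bd_P] in place of i_{m,n} pi_m; the value 0
   for k < 2, where phi is not defined, encodes i_{1,2}(t e_1) = t e_1. *)
Definition bd_functional (k : nat) (y : nat -> R) : R :=
  if (k < 2)%N then 0 else
  a * (-1) ^+ bd_s1 (phi k) * y (bd_i (phi k)) +
  b * (-1) ^+ bd_s2 (phi k) * (y (bd_j (phi k)) -
    bd_P a b d phi (bd_m (phi k)) y (bd_j (phi k))).

(** Turns P_m into a recursion on the coordinate, so that later proofs run by strong induction on k
    instead of over stages. Every coordinate read by f_{phi(k)} lies below [d n], where stage n
    already agrees with the limit. *)
Lemma bd_P_step m (x : nat -> R) k : (1 <= m)%N -> (d m <= k)%N ->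
  bd_P a b d phi m x k = bd_functional k (bd_P a b d phi m x).
Proof.
have [d1 d2 dS] := hphi => m1 mk; rewrite /bd_functional; case: ltnP => k2.
  (* Below 2 the only case is m = k = 1, where i_{1,2} puts the value 0. *)
  have k1 : k = 1%N.
    by have := bd_dim_le (leqnn 1) m1; rewrite d1; lia.
  have -> : m = 1%N.
    case: m m1 mk => [//|[//|m]] _.
    by have := @bd_dim_le 2 m.+2 isT isT; rewrite d2 k1; lia.
  by rewrite k1 (@bd_PE 1 2) ?d2//= /bd_proj d1 addr0.
have [n n2 kn] := bd_stage k2; have /andP[nk kn1] := kn.
have mn : (m <= n)%N.
  rewrite leqNgt; apply/negP => nm.
  by have := @bd_dim_le n.+1 m isT nm; lia.
have n1 : (1 <= n)%N by lia.
have [/andP[p1 pn] ip jn] := bd_phi_range n2 kn.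
rewrite (@bd_PE m n.+1)//= mn n2 nk kn1 /= bd_ext_support// add0r.
have im : (bd_i (phi k) < d n)%N.
  by rewrite (leq_trans ip)// bd_dim_le// ltnW.
have -> : bd_P a b d phi (bd_m (phi k)) (bd_P a b d phi m x) =
    bd_P a b d phi (bd_m (phi k)) (bd_ext a b d phi m n (bd_proj d m x)).
  apply: bd_P_local => l lp; apply: bd_PE => //.
  by rewrite (leq_trans lp)// bd_dim_le// ltnW.
rewrite (@bd_PE m n)// (@bd_PE m n _ (bd_j _))// (@bd_PE (bd_m _) n)//.
by case: (phi k).
Qed.

Lemma bd_phi_lt k : (2 <= k)%N ->
  [/\ (1 <= bd_m (phi k))%N, (bd_i (phi k) < d (bd_m (phi k)))%N,
      (bd_j (phi k) < k)%N & (d (bd_m (phi k)) <= k)%N].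
Proof.
move=> k2; have [n n2 kn] := bd_stage k2; have /andP[nk _] := kn.
have [/andP[p1 pn] ip jn] := bd_phi_range n2 kn.
split=> //; first exact: leq_trans nk.
by rewrite (leq_trans _ nk)// bd_dim_le// ltnW.
Qed.

(** The recursion is triangular: writing p for [bd_m (phi k)], the indices satisfy i < d p <= k and
    j < k, and P_p reads only the first d p coordinates. *)
Lemma bd_functional_local k (y z : nat -> R) :
  (forall l, (l < k)%N -> y l = z l) -> bd_functional k y = bd_functional k z.
Proof.
move=> yz; rewrite /bd_functional; case: ltnP => // /bd_phi_lt[p1 ip jk pk].
rewrite !yz//; last exact: leq_trans pk.
by rewrite (@bd_P_local _ y z)// => l lp; rewrite yz// (leq_trans lp).
Qed.

(* Characterizes the range of [bd_P m]. *)
Definition bd_consistent (m : nat) (y : nat -> R) :=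
  forall k, (d m <= k)%N -> y k = bd_functional k y.

Lemma bd_P_consistent m x : (1 <= m)%N -> bd_consistent m (bd_P a b d phi m x).
Proof. by move=> m1 k; exact: bd_P_step. Qed.

Lemma bd_consistent_le m p y : (1 <= m)%N -> (m <= p)%N ->
  bd_consistent m y -> bd_consistent p y.
Proof. by move=> m1 mp ym k pk; apply: ym; exact: leq_trans (bd_dim_le m1 mp) pk. Qed.

(** Both sequences agree below [d p] and obey the same triangular recursion from there on. *)
Lemma bd_P_id p y : (1 <= p)%N -> bd_consistent p y -> bd_P a b d phi p y = y.
Proof.
move=> p1 yp; apply/funext; elim/ltn_ind => k IH.
have [kp|pk] := ltnP k (d p); first exact: bd_P_init.
by rewrite bd_P_step// yp//; exact: bd_functional_local.
Qed.

Lemma bd_P_linear m (t : R) x y k : (1 <= m)%N ->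
  bd_P a b d phi m (fun l => t * x l + y l) k =
  t * bd_P a b d phi m x k + bd_P a b d phi m y k.
Proof.
elim/ltn_ind: k m x y => k IH m x y m1.
have [km|mk] := ltnP k (d m); first by rewrite !bd_P_init.
rewrite !bd_P_step// /bd_functional; case: ltnP => k2.
  by rewrite mulr0 addr0.
have [p1 ip jk pk] := bd_phi_lt k2.
(* The inner projection reads only coordinates below [d (bd_m (phi k))], which is at most k, so the
   induction hypothesis applies inside it. *)
rewrite (@bd_P_local _ (bd_P a b d phi m (fun l => t * x l + y l))
  (fun l => t * bd_P a b d phi m x l + bd_P a b d phi m y l)); last first.
  by move=> l lp; rewrite IH// (leq_trans lp).
rewrite !IH//; last exact: leq_trans pk.
by ring.
Qed.

Lemma bd_functional_linear k (t : R) x y :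
  bd_functional k (fun l => t * x l + y l) =
  t * bd_functional k x + bd_functional k y.
Proof.
rewrite /bd_functional; case: ltnP => k2; first by rewrite mulr0 addr0.
by have [p1 ip jk pk] := bd_phi_lt k2; rewrite bd_P_linear//; ring.
Qed.

Lemma bd_consistent_linear m t x y : bd_consistent m x -> bd_consistent m y ->
  bd_consistent m (fun l => t * x l + y l).
Proof. by move=> xm ym k mk; rewrite bd_functional_linear xm// ym. Qed.

Lemma bd_functionalB k x y :
  bd_functional k (fun l => x l - y l) = bd_functional k x - bd_functional k y.
Proof.
have -> : (fun l => x l - y l) = (fun l => (-1) * y l + x l).
  by apply/funext => l; rewrite mulN1r addrC.
by rewrite bd_functional_linear mulN1r addrC.
Qed.

Lemma bd_consistentB m x y : bd_consistent m x -> bd_consistent m y ->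
  bd_consistent m (fun l => x l - y l).
Proof. by move=> xm ym k mk; rewrite bd_functionalB xm// ym. Qed.

Lemma bd_functionalD k x y :
  bd_functional k (fun l => x l + y l) = bd_functional k x + bd_functional k y.
Proof.
rewrite -[bd_functional k x]mul1r -bd_functional_linear.
by congr bd_functional; apply/funext => l; rewrite mul1r.
Qed.

Lemma bd_PD m x y k : (1 <= m)%N ->
  bd_P a b d phi m (fun l => x l + y l) k =
  bd_P a b d phi m x k + bd_P a b d phi m y k.
Proof.
move=> m1; rewrite -[bd_P _ _ _ _ m x k]mul1r -bd_P_linear//.
by congr bd_P; apply/funext => l; rewrite mul1r.
Qed.

Lemma bd_functional0 k : bd_functional k (fun=> 0) = 0.
Proof.
have := @bd_functional_linear k (-1) (fun=> 0) (fun=> 0).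
by rewrite mulN1r addNr => f0; rewrite {1}f0 mulN1r addNr.
Qed.

Lemma bd_consistent0 m : bd_consistent m (fun=> 0).
Proof. by move=> k _; rewrite bd_functional0. Qed.

Lemma bd_consistentD m x y : bd_consistent m x -> bd_consistent m y ->
  bd_consistent m (fun l => x l + y l).
Proof. by move=> xm ym k mk; rewrite bd_functionalD xm// ym. Qed.

(** * Uniform bound on the projections *)

Variable lambda : R.
Hypotheses (b_gt0 : 0 < b) (a_gt0 : 0 < a) (a_lt1 : a < 1)
  (lambda_gt1 : 1 < lambda) (ab_lambda : a + 2 * b * lambda < lambda).

(** Write p for [bd_m (phi k)]. If m <= p, then P_p fixes P_m x, only the a-term remains, and a < 1
    suffices. If p < m, coordinate i is still one of the given ones, hence at most M and not merely
    lambda M, and the total is (a + 2 b lambda) M <= lambda M. *)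
Lemma bd_P_bound m x (M : R) k : (1 <= m)%N ->
  (forall l, (l < d m)%N -> `|x l| <= M) -> `|bd_P a b d phi m x k| <= lambda * M.
Proof.
elim/ltn_ind: k m x => k IH m x m1 xM.
have M0 : 0 <= M.
  by rewrite (le_trans _ (xM 0%N _))// (leq_trans _ (bd_dim_ge m1)).
have lM : M <= lambda * M by rewrite ler_peMl// ltW.
have [km|mk] := ltnP k (d m).
  by rewrite bd_P_init// (le_trans (xM _ _)).
rewrite bd_P_step// /bd_functional; case: ltnP => k2.
  by rewrite normr0 (le_trans M0).
have [p1 ip jk pk] := bd_phi_lt k2.
have sgn (s : bool) : `|(-1) ^+ s| = 1 :> R by rewrite normrX normrN1 expr1n.
have b0 := ltW b_gt0; have a0 := ltW a_gt0.
have [pm|mp] := ltnP (bd_m (phi k)) m; last first.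
  rewrite (@bd_P_id (bd_m (phi k))) ?subrr ?mulr0 ?addr0; first last.
  - exact: bd_consistent_le (bd_P_consistent _ m1).
  - by [].
  rewrite !normrM sgn mulr1 (ger0_norm a0).
  have Hi := IH _ (leq_trans ip pk) m x m1 xM.
  by rewrite (le_trans (ler_wpM2l a0 Hi))// ler_piMl ?(le_trans M0)// ltW.
rewrite (bd_P_init _ m1); last by rewrite (leq_trans ip)// bd_dim_le// ltnW.
have Hi : `|x (bd_i (phi k))| <= M.
  by rewrite xM// (leq_trans ip)// bd_dim_le// ltnW.
have Hj := IH _ jk m x m1 xM.
have Hp : `|bd_P a b d phi (bd_m (phi k)) (bd_P a b d phi m x) (bd_j (phi k))|
    <= lambda * M.
  apply: IH => // l lp.
  have lm : (l < d m)%N by rewrite (leq_trans lp)// bd_dim_le// ltnW.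
  by rewrite bd_P_init// xM.
rewrite (le_trans (ler_normD _ _))// !normrM !sgn !mulr1.
rewrite (ger0_norm a0) (ger0_norm b0).
have H1 := ler_wpM2l a0 Hi.
have H2 := ler_wpM2l b0 (le_trans (ler_normB _ _) (lerD Hj Hp)).
have H3 : (a + 2 * b * lambda) * M <= lambda * M by rewrite ler_wpM2r// ltW.
by apply: le_trans (lerD H1 H2) _; lra.
Qed.

Hypothesis b_lt_a : b < a.

(** * Sums of successive blocks *)

Variable C : R.
Hypothesis C_ge0 : 0 <= C.

(* Lists of successive block vectors, the latest vector first. *)
Inductive bd_blocks : nat -> seq (nat -> R) -> Prop :=
| bd_blocks_nil M : (1 <= M)%N -> bd_blocks M [::]
| bd_blocks_cons p M w ws : bd_blocks p ws -> (p <= M)%N ->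
    (forall k, `|w k| <= C) -> (forall k, (k < d p)%N -> w k = 0) ->
    bd_consistent M w -> bd_blocks M (w :: ws).

Definition seq_sum (ws : seq (nat -> R)) : nat -> R :=
  fun l => \sum_(w <- ws) w l.

Lemma seq_sum_nil : seq_sum [::] = fun=> 0.
Proof. by apply/funext => l; rewrite /seq_sum big_nil. Qed.

Lemma seq_sum_cons w ws : seq_sum (w :: ws) = fun l => w l + seq_sum ws l.
Proof. by apply/funext => l; rewrite /seq_sum big_cons. Qed.

Lemma bd_blocks_ge1 M ws : bd_blocks M ws -> (1 <= M)%N.
Proof. by elim=> // p {}M w {}ws _ p1 pM _ _ _; exact: leq_trans pM. Qed.

Lemma bd_blocks_consistent M ws : bd_blocks M ws -> bd_consistent M (seq_sum ws).
Proof.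
elim=> [{}M _|p {}M w {}ws wsp IH pM _ _ wM].
  by rewrite seq_sum_nil; exact: bd_consistent0.
rewrite seq_sum_cons; apply: bd_consistentD => //.
exact: bd_consistent_le (bd_blocks_ge1 wsp) pM IH.
Qed.

Lemma bd_functional_bound k w : (forall l, `|w l| <= C) ->
  `|bd_functional k w| <= (a + b * (1 + lambda)) * C.
Proof.
move=> wC; rewrite /bd_functional; case: ltnP => k2.
  by rewrite normr0 mulr_ge0// addr_ge0 ?mulr_ge0 ?addr_ge0 ?ltW// (lt_trans _ lambda_gt1).
have [p1 ip jk pk] := bd_phi_lt k2.
have sgn (s : bool) : `|(-1) ^+ s| = 1 :> R by rewrite normrX normrN1 expr1n.
rewrite (le_trans (ler_normD _ _))// !normrM !sgn !mulr1.
rewrite (gtr0_norm a_gt0) (gtr0_norm b_gt0) mulrDl -mulrA lerD//.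
  by rewrite ler_pM2l.
rewrite ler_pM2l// (le_trans (ler_normB _ _))// mulrDl mul1r lerD//.
exact: bd_P_bound.
Qed.

(** Blocks starting after l vanish up to l, and blocks complete before l already satisfy the
    recursion there; at most one block contributes. *)
Lemma bd_blocks_defect M ws l : bd_blocks M ws ->
  `|seq_sum ws l - bd_functional l (seq_sum ws)|
    <= (1 + (a + b * (1 + lambda))) * C.
Proof.
elim=> [{}M _|p {}M w {}ws wsp IH pM wC w0 wM].
  rewrite seq_sum_nil bd_functional0 subrr normr0 mulr_ge0//.
  by rewrite !addr_ge0 ?mulr_ge0 ?addr_ge0 ?ltW// (lt_trans _ lambda_gt1).
rewrite seq_sum_cons bd_functionalD; have [lp|pl] := ltnP l (d p).
  rewrite (@bd_functional_local l w (fun=> 0)); last first.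
    by move=> i il; rewrite w0// (ltn_trans il).
  by rewrite bd_functional0 w0// !add0r.
rewrite (bd_blocks_consistent wsp pl) opprD addrACA subrr addr0.
rewrite (le_trans (ler_normB _ _))// mulrDl mul1r lerD//.
exact: bd_functional_bound.
Qed.

(** [ws1] collects the blocks starting from [d m] on, which P_m annihilates, and [ws2] the others.
    P_m fixes all of [ws2] except possibly its latest block, the source of the error (1 + lambda)
    C. *)
Lemma bd_blocks_split M ws m : bd_blocks M ws -> (1 <= m)%N ->
  exists ws1 ws2 M2,
    [/\ bd_blocks M ws1, bd_blocks M2 ws2,
        (size ws1 + size ws2 <= size ws)%N,
        (forall i, (i < d m)%N -> seq_sum ws i = seq_sum ws2 i)
      & forall j, `|seq_sum ws j - bd_P a b d phi m (seq_sum ws) j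
                    - seq_sum ws1 j| <= (1 + lambda) * C].
Proof.
move=> + m1; have l0 : 0 <= (1 + lambda) * C.
  by rewrite mulr_ge0// addr_ge0// ltW// (lt_trans _ lambda_gt1).
elim=> [{}M M1|p {}M w {}ws wsp IH pM wC w0 wM].
  exists [::], [::], M; split => //; [exact: bd_blocks_nil..|].
  move=> j; rewrite seq_sum_nil bd_P_id//; last exact: bd_consistent0.
  by rewrite !subr0 normr0.
have [mp|pm] := leqP m p.
  have w0m i : (i < d m)%N -> w i = 0.
    by move=> im; rewrite w0// (leq_trans im)// bd_dim_le.
  have [ws1 [ws2 [M2 [b1 b2 s12 s2 s1]]]] := IH.
  exists (w :: ws1), ws2, M2; split => //.
  - exact: bd_blocks_cons b1 pM wC w0 wM.
  - by rewrite seq_sum_cons => i im; rewrite w0m// add0r s2.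
  move=> j; rewrite !seq_sum_cons (@bd_P_local m _ (seq_sum ws)); last first.
    by move=> i im; rewrite w0m// add0r.
  rewrite [X in `|X|](_ : _ = seq_sum ws j -
    bd_P a b d phi m (seq_sum ws) j - seq_sum ws1 j) //; by ring.
have wsm : bd_P a b d phi m (seq_sum ws) = seq_sum ws.
  apply: bd_P_id => //; apply: bd_consistent_le (bd_blocks_consistent wsp).
    exact: bd_blocks_ge1 wsp.
  exact: ltnW.
exists [::], (w :: ws), M; split => //.
- by apply: bd_blocks_nil; exact: leq_trans (bd_blocks_ge1 wsp) pM.
- exact: bd_blocks_cons wsp pM wC w0 wM.
move=> j; rewrite seq_sum_nil subr0 seq_sum_cons bd_PD// wsm opprD addrACA subrr.
rewrite addr0 (le_trans (ler_normB _ _))// mulrDl mul1r lerD//.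
exact: bd_P_bound.
Qed.

(* Writing the coordinate functional as its defect plus [bd_functional], a sum
   of n blocks is at most C' + a (sum of n1 blocks) + b (sum of n2 blocks) with
   n1 + n2 <= n; so a linear bound tau n + K improves to a tau n + K'. *)
Lemma bd_blocks_estimate t : exists2 K, 0 <= K &
  forall M ws l, bd_blocks M ws ->
    `|seq_sum ws l| <= a ^+ t * C * (size ws)%:R + K.
Proof.
elim: t => [|t [K K0 HK]].
  exists 0 => // M ws l; elim=> [{}M _|p {}M w {}ws wsp IH _ wC _ _].
    by rewrite seq_sum_nil normr0 mulr0 addr0.
  rewrite seq_sum_cons (le_trans (ler_normD _ _))//= -natr1 mulrDr mulr1.
  by rewrite expr0 mul1r addr0 addrC lerD// (le_trans IH)// expr0 mul1r addr0.
have a0 := ltW a_gt0; have b0 := ltW b_gt0.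
have l0 : 0 <= lambda by rewrite ltW// (lt_trans _ lambda_gt1).
set D := (1 + (a + b * (1 + lambda))) * C.
have D0 : 0 <= D by rewrite mulr_ge0 ?addr_ge0 ?mulr_ge0 ?addr_ge0.
set E := (1 + lambda) * C.
have E0 : 0 <= E by rewrite mulr_ge0 ?addr_ge0.
exists (D + (a * K + b * (E + K))) => [|M ws l wsM].
  by rewrite !addr_ge0// !mulr_ge0// addr_ge0.
have DM := bd_blocks_defect l wsM.
rewrite -[seq_sum ws l](subrK (bd_functional l (seq_sum ws))).
have T0 : 0 <= a ^+ t * C by rewrite mulr_ge0// exprn_ge0.
rewrite addrCA (le_trans (ler_normD _ _))// lerD//.
rewrite /bd_functional; case: ltnP => l2.
  by rewrite normr0 addr_ge0// ?mulr_ge0 ?exprn_ge0// !addr_ge0 ?mulr_ge0 ?addr_ge0.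
have [p1 ip _ _] := bd_phi_lt l2.
have [ws1 [ws2 [M2 [b1 b2 s12 s2 s1]]]] := bd_blocks_split wsM p1.
have sgn (s : bool) : `|(-1) ^+ s| = 1 :> R by rewrite normrX normrN1 expr1n.
rewrite (le_trans (ler_normD _ _))// !normrM !sgn !mulr1.
rewrite (ger0_norm a0) (ger0_norm b0) s2//.
have H2 := HK _ _ (bd_i (phi l)) b2.
have H1 := HK _ _ (bd_j (phi l)) b1.
have H3 : `|seq_sum ws (bd_j (phi l)) -
    bd_P a b d phi (bd_m (phi l)) (seq_sum ws) (bd_j (phi l))|
    <= E + (a ^+ t * C * (size ws1)%:R + K).
  rewrite -[X in `|X|](subrK (seq_sum ws1 (bd_j (phi l)))).
  by rewrite (le_trans (ler_normD _ _))// lerD.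
rewrite (le_trans (lerD (ler_wpM2l a0 H2) (ler_wpM2l b0 H3)))//.
(* As b < a, both weights can be raised to a, and then the two sizes add up to at most the size of
   [ws]. *)
have H4 : b * (a ^+ t * C * (size ws1)%:R) <= a * (a ^+ t * C * (size ws1)%:R).
  by apply: ler_wpM2r; [rewrite mulr_ge0|exact: ltW].
have H5 : a * (a ^+ t * C * ((size ws1)%:R + (size ws2)%:R)) <=
    a * (a ^+ t * C * (size ws)%:R).
  by rewrite !ler_wpM2l// -natrD ler_nat.
rewrite exprS; set A := a ^+ t * C in H4 H5 *; rewrite -(mulrA a) -/A.
lra.
Qed.

End Projections.

(** * Approximation by blocks and the game on vectors of the space *)

Section BlockSums.
Variables (R : realType) (a b : R) (d : nat -> nat) (phi : nat -> bd_tuple).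
Hypothesis hphi : bd_enumeration d phi.

Local Notation X := (bd_space a b d phi).

Definition bd_coord (k : nat) (x : X) : R := \val (\val x) k.

Lemma bd_coord_linear k : linear (bd_coord k : X -> R^o).
Proof. by move=> t x y; rewrite /bd_coord !linearP. Qed.

HB.instance Definition _ k :=
  GRing.isLinear.Build R X R^o _ (bd_coord k) (bd_coord_linear k).

Lemma bd_coord_norm k x : `|bd_coord k x| <= `|x|.
Proof. exact: (bfun_norm_ge (\val x)). Qed.

Lemma bd_norm_le x M : 0 <= M -> (forall k, `|bd_coord k x| <= M) -> `|x| <= M.
Proof. by move=> M0 xM; exact: (@bfun_norm_le _ _ (\val x)). Qed.

(** A finite combination involves finitely many stages, and consistency persists to the largest of
    them. *)
Lemma bd_span_consistent (v : bfun R nat) :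
  linear_span (bd_generators a b d phi) v ->
  exists2 m, (1 <= m)%N & bd_consistent a b d phi m (\val v).
Proof.
move=> [n [c [u [gu ->]]]]; elim: n c u gu => [|n IH] c u gu.
  by exists 1%N => //; rewrite big_ord0; exact: bd_consistent0.
have [m m1 Hm] := IH (c \o lift ord0) (u \o lift ord0) (fun i => gu _).
have [p [x [p1 _ ux]]] := gu ord0.
exists (maxn m p); first by rewrite leq_max m1.
rewrite big_ord_recl.
have -> : \val (c ord0 *: u ord0 + \sum_(i < n) c (lift ord0 i) *: u (lift ord0 i))
  = (fun k => c ord0 * bd_P a b d phi p (\val x) k +
      \val (\sum_(i < n) c (lift ord0 i) *: u (lift ord0 i)) k) :> (nat -> R).
  by rewrite bfunD bfunZ ux.
apply: (bd_consistent_linear hphi).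
  exact: (bd_consistent_le hphi p1 (leq_maxr _ _) (bd_P_consistent a b hphi _ p1)).
exact: (bd_consistent_le hphi m1 (leq_maxl _ _) Hm).
Qed.

Lemma bd_space_approx (x : X) (eta : R) : 0 < eta ->
  exists m v, [/\ (1 <= m)%N, bd_consistent a b d phi m v
                & forall k, `|bd_coord k x - v k| <= eta].
Proof.
move=> eta0; have /asboolP/(_ _ (nbhsx_ballx _ _ eta0))[v [vS]] := valP x.
rewrite -ball_normE /= => /ltW xv.
have [m m1 vm] := bd_span_consistent vS.
exists m, (\val v); split => // k.
by apply: le_trans xv; exact: (bfun_norm_ge (\val x - v)).
Qed.

Variable lambda : R.
Hypotheses (b_gt0 : 0 < b) (b_lt_a : b < a) (a_lt1 : a < 1)
  (lambda_gt1 : 1 < lambda) (ab_lambda : a + 2 * b * lambda < lambda).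

(** Approximate x by a consistent v and take w = v - P_p v. Below [d p], v is at most 2 eta, so P_p
    v is at most 2 lambda eta everywhere; this gives the constant. *)
Lemma bd_space_block (x : X) (C eta : R) p : (1 <= p)%N -> 0 < eta ->
  `|x| <= C -> (forall k, (k < d p)%N -> `|bd_coord k x| <= eta) ->
  exists M w, [/\ (p <= M)%N, bd_consistent a b d phi M w,
    forall k, (k < d p)%N -> w k = 0
    & forall k, `|bd_coord k x - w k| <= (1 + 2 * lambda) * eta].
Proof.
move=> p1 eta0 xC xeta; have a_gt0 := lt_trans b_gt0 b_lt_a.
have [m [v [m1 vm xv]]] := bd_space_approx x eta0.
exists (maxn m p), (fun k => v k - bd_P a b d phi p v k); split.
- exact: leq_maxr.
- apply: (bd_consistentB hphi).
    exact: (bd_consistent_le hphi m1 (leq_maxl _ _) vm).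
  exact: (bd_consistent_le hphi p1 (leq_maxr _ _) (bd_P_consistent a b hphi _ p1)).
- by move=> k kp; rewrite (bd_P_init a b hphi _ p1 kp) subrr.
have vp k : (k < d p)%N -> `|v k| <= 2 * eta.
  move=> kp; rewrite -[v k](subrK (bd_coord k x)) mulr2n mulrDl mul1r.
  by rewrite (le_trans (ler_normD _ _))// lerD ?xeta// distrC.
move=> k; have Pk := bd_P_bound hphi b_gt0 a_gt0 a_lt1 lambda_gt1 ab_lambda k p1 vp.
rewrite opprD opprK addrA (le_trans (ler_normD _ _))//.
apply: le_trans (lerD (xv k) Pk) _.
lra.
Qed.

(* [G r xs] is a position, with r moves left and the vectors xs already chosen,
   of a game in which each new vector must be small on a prescribed finite set
   of coordinates. *)
Lemma bd_tree_sum (C delta : R) : 0 < C -> 0 < delta ->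
  exists2 n, (0 < n)%N & forall G : nat -> seq X -> Prop,
    (forall r xs, G r.+1 xs -> forall N eta, 0 < eta ->
       exists x, [/\ `|x| <= C, forall k, (k < N)%N -> `|bd_coord k x| <= eta
                   & G r (x :: xs)]) ->
    G n [::] ->
    exists xs, [/\ size xs = n, G 0%N xs & `|\sum_(x <- xs) x| <= delta * n%:R].
Proof.
move=> C0 delta0; have a_gt0 := lt_trans b_gt0 b_lt_a.
have l0 : 0 < 1 + 2 * lambda.
  by rewrite addr_gt0 ?mulr_gt0 ?(lt_trans _ lambda_gt1).
(* Replacing a vector by its block costs (1 + 2 lambda) eta = delta / 2. The other half of delta is
   shared by a^t D n and K in the block estimate, delta n / 4 each. *)
pose eta := delta / (2 * (1 + 2 * lambda)).
have eta0 : 0 < eta by rewrite divr_gt0// mulr_gt0.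
pose D := C + (1 + 2 * lambda) * eta.
have etaE : (1 + 2 * lambda) * eta = delta / 2.
  by rewrite /eta; field; rewrite lt0r_neq0.
have D0 : 0 < D by rewrite addr_gt0// mulr_gt0.
have [t tD] : exists t, a ^+ t * D <= delta / 4.
  have : (fun t => a ^+ t) @ \oo --> (0 : R).
    by apply: cvg_expr; rewrite gtr0_norm.
  move=> /cvgr0Pnorm_le/(_ (delta / 4 / D)).
  case=> [|t _ /(_ t (leqnn t)) /=]; first by rewrite !divr_gt0.
  by rewrite ler_pdivlMr// normrX gtr0_norm//; exists t.
have [K K0 HK] := bd_blocks_estimate hphi b_gt0 a_gt0 a_lt1 lambda_gt1 ab_lambda
  b_lt_a (ltW D0) t.
pose n := (Num.truncn (K / (delta / 4))).+1.
have Kn : K <= delta / 4 * n%:R.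
  by rewrite mulrC -ler_pdivrMr ?divr_gt0// ltW// truncnS_gt.
exists n => // G Gstep G0.
(* The induction carries along a list of blocks whose sum approximates the sum of the chosen
   vectors. *)
suff H r xs ws p : G r xs -> bd_blocks a b d phi D p ws -> size xs = size ws ->
    (forall k, `|bd_coord k (\sum_(x <- xs) x) - seq_sum ws k|
       <= delta / 2 * (size ws)%:R) ->
    exists xs' ws' p', [/\ size xs' = (r + size xs)%N, G 0%N xs',
      bd_blocks a b d phi D p' ws', size xs' = size ws' &
      forall k, `|bd_coord k (\sum_(x <- xs') x) - seq_sum ws' k|
       <= delta / 2 * (size ws')%:R].
  have [|xs [ws [p [xsn Gxs wsp xsws xw]]]] :=
      H n [::] [::] 1%N G0 (bd_blocks_nil _ _ _ _ _ (leqnn _)) erefl.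
    by move=> k; rewrite seq_sum_nil big_nil subr0 [bd_coord k 0]/= normr0 mulr0.
  rewrite addn0 in xsn; exists xs; split => //.
  apply: bd_norm_le => [|k]; first by rewrite mulr_ge0// ltW.
  rewrite -[bd_coord k _](subrK (seq_sum ws k)) (le_trans (ler_normD _ _))//.
  have := xw k; have := HK _ _ k wsp; rewrite -xsws xsn => H1 H2.
  have H3 : a ^+ t * D * n%:R <= delta / 4 * n%:R by rewrite ler_wpM2r.
  by move: H1 H2 H3 Kn; move: (n%:R) => u; lra.
elim: r xs ws p => [|r IH] xs ws p Gr wsp xsws xw.
  by exists xs, ws, p.
have p1 := bd_blocks_ge1 wsp.
(* Smallness is demanded below [d p], where p is the stage reached by the earlier blocks; this makes
   the new vector almost successive to them. *)
have [x [xC xp Gx]] := Gstep _ _ Gr (d p) eta eta0.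
have [M [w [pM wM w0 xwk]]] := bd_space_block p1 eta0 xC xp.
have [|||xs' [ws' [p' [s1 G1 b1 s2 e1]]]] := IH (x :: xs) (w :: ws) M Gx.
- apply: bd_blocks_cons wsp pM _ w0 wM => k.
  rewrite -[w k](subrK (bd_coord k x)) (le_trans (ler_normD _ _))// addrC lerD//.
    exact: le_trans (bd_coord_norm _ _) xC.
  by rewrite distrC.
- by rewrite /= xsws.
- move=> k; rewrite big_cons [bd_coord k (_ + _)]raddfD seq_sum_cons opprD addrACA.
  rewrite (le_trans (ler_normD _ _))//= -[(size ws).+1%:R]natr1 mulrDr mulr1 [leRHS]addrC lerD//.
  by rewrite -etaE.
by exists xs', ws', p'; split => //; rewrite s1 /= addnS.
Qed.

End BlockSums.

(** * Szlenk derivations *)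

Section FiniteOrdinals.

Lemma ex_ord_zero : exists al : omega1, ord_zero al.
Proof.
have [|al _ al_le] := @omega1_well_ordered setT; last first.
  by exists al => be; exact: al_le.
apply/set0P/eqP => T0; apply: omega1_uncountable; rewrite T0; exact: countable0.
Qed.

(** If nothing were larger than [be], [omega1] would coincide with the countable set of elements up
    to [be]. *)
Lemma ex_ord_succ (be : omega1) : exists al, ord_succ be al.
Proof.
have [|al be_al al_le] := @omega1_well_ordered [set ga | (be < ga)%O].
  apply: contrapT => nlt; apply: omega1_uncountable.
  apply: sub_countable (omega1_countable be); apply: subset_card_le => ga _ /=.
  by rewrite leNgt; apply/negP => lt; apply: nlt; exists ga.
by exists al; split=> // ga /al_le.
Qed.

Lemma ord_succ_lt (be al ga : omega1) :
  ord_succ be al -> (ga < al)%O -> (ga <= be)%O.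
Proof.
move=> [_ succ] ga_al; rewrite leNgt; apply/negP => /succ.
by rewrite leNgt ga_al.
Qed.

Variables (R : realType) (V : normedModType R) (eps : R) (B : set (dual V)).

(** A successor is neither zero nor a limit, and its predecessor is unique, so only one constructor
    can apply. *)
Lemma szlenk_set_succE be al f : ord_succ be al ->
  szlenk_set eps B al f -> szlenk_derived eps B (szlenk_set eps B be) f.
Proof.
move=> succ sf; case: sf succ => {al f}.
- move=> al f al0 _ [be_al _]; have := al0 be.
  by rewrite leNgt be_al.
- move=> ga al f succ' Df succ; suff -> : be = ga by [].
  apply/le_anti; rewrite (ord_succ_lt succ' succ.1).
  exact: ord_succ_lt succ succ'.1.
- by move=> al f [_ nsucc] _ /nsucc.
Qed.

Lemma szlenk_derivedS (P Q : set (dual V)) :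
  P `<=` Q -> szlenk_derived eps B P `<=` szlenk_derived eps B Q.
Proof.
move=> PQ f [Bf [x [g [l [xg gf gl epsl x0]]]]]; split=> //.
by exists x, g, l; split => // n; have [? /PQ] := xg n.
Qed.

(** With [al] the n-th successor of zero, a finite stage of the recursion can be studied as a plain
    iterate of the derivation. *)
Lemma ex_ord_szlenk_iter n : exists2 al : omega1,
  finite_set [set ga : omega1 | (ga < al)%O] &
  szlenk_set eps B al `<=` iter n (szlenk_derived eps B) B.
Proof.
elim: n => [|n [be be_fin IH]].
  have [al al0] := ex_ord_zero; exists al.
    rewrite (_ : [set _ | _] = set0)//; apply/seteqP; split=> // ga /=.
    by rewrite ltNge al0.
  move=> f sf; case: sf al0 => //.
    move=> {}al ga g [lt _] _ zero; have := zero al.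
    by rewrite leNgt lt.
  by move=> ga g [nz _] _ /nz.
have [al succ] := ex_ord_succ be; exists al.
  apply: (@sub_finite_set _ _ ([set ga | (ga < be)%O] `|` [set be])).
    move=> ga /= /(ord_succ_lt succ); rewrite le_eqVlt => /orP[/eqP|]; first by right.
    by left.
  by rewrite finite_setU; split => //; exact: finite_set1.
move=> f /(szlenk_set_succE succ); exact: szlenk_derivedS.
Qed.

(** Well-ordering supplies a least ordinal at which the sets die, so the value is not [None], and it
    is at most the finite ordinal of stage n. *)
Lemma szlenk_eta_lt_omega n :
  iter n (szlenk_derived eps B) B = set0 -> lt_omega (szlenk_eta eps B).
Proof.
move=> Dn; have [al al_fin] := ex_ord_szlenk_iter n; rewrite Dn subset0 => al0.
rewrite /szlenk_eta; case: pselect => [ex|nex] /=.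
  case: cid => be /= [_ be_le].
  apply: sub_finite_set al_fin => ga /= /lt_le_trans; apply; exact: be_le.
apply: nex; have [|be dies be_le] := @omega1_well_ordered (szlenk_dies eps B).
  by exists al.
by exists be.
Qed.

End FiniteOrdinals.

Section NormedModules.
Variables (R : realType) (V W : normedModType R).

Lemma continuous_linear_bound (f : {linear V -> W}) : continuous f ->
  exists2 M, 0 < M & forall x, `|f x| <= M * `|x|.
Proof.
move=> /linear_bounded_continuous/linear_boundedP; case/pinfty_ex_gt0 => M M0 fM.
by exists M.
Qed.

Lemma linear_continuous_bound (f : {linear V -> W}) M :
  (forall x, `|f x| <= M * `|x|) -> continuous f.
Proof.
move=> fM; apply/linear_bounded_continuous/linear_boundedP.
exists M; split => [|N /ltW MN x]; first exact: num_real.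
by rewrite (le_trans (fM x))// ler_wpM2r.
Qed.

End NormedModules.

Lemma dual_ball_le (R : realType) (V : normedModType R) (f : dual V) x :
  dual_ball f -> `|f x| <= `|x|.
Proof.
move=> f1; have [M M0 fM] := continuous_linear_bound (@dual_continuous _ _ f).
(* [sup] takes a default value on unbounded sets; continuity of f provides the bound that makes
   [dual_norm] a genuine supremum. *)
have ub : has_ubound [set `|f y| | y in @unit_ball R V].
  exists M => _ [y y1 <-]; rewrite (le_trans (fM y))// ler_piMr//; exact: ltW.
have [->|x0] := eqVneq x 0; first by rewrite linear0 !normr0.
have nx0 : 0 < `|x| by rewrite normr_gt0.
have : `|f (`|x|^-1 *: x)| <= 1.
  apply: le_trans f1; apply: ub_le_sup => //; exists (`|x|^-1 *: x) => //.
  by rewrite /unit_ball /= normrZ normfV normr_id mulVf ?lt0r_neq0.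
by rewrite linearZ normrZ normfV normr_id ler_pdivrMl// mulr1.
Qed.

Section Szlenk.
Variables (R : realType) (a b lambda : R) (d : nat -> nat) (phi : nat -> bd_tuple).
Hypotheses (hphi : bd_enumeration d phi) (b_gt0 : 0 < b) (b_lt_a : b < a)
  (a_lt1 : a < 1) (lambda_gt1 : 1 < lambda)
  (ab_lambda : a + 2 * b * lambda < lambda).

Local Notation X := (bd_space a b d phi).

Lemma bd_coord_continuous k : continuous (bd_coord k : X -> R^o).
Proof.
apply: (@linear_continuous_bound _ _ _ _ 1) => x; rewrite mul1r.
exact: bd_coord_norm.
Qed.

Lemma weakly_null_bd_coord (x : nat -> X) N eta : weakly_null x -> 0 < eta ->
  \forall n \near \oo, forall k, (k < N)%N -> `|bd_coord k (x n)| <= eta.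
Proof.
move=> x0 eta0; elim: N => [|N IH]; first by exists 0%N.
have /cvgr0Pnorm_le/(_ eta eta0) HN := x0 (Dual (@bd_coord_continuous N)).
apply: filterS2 IH HN => n Hn HN k; rewrite ltnS leq_eqVlt => /orP[/eqP->//|].
exact: Hn.
Qed.

Lemma weak_star_cvg_gt (g : nat -> dual X) f (c : R) (xs : seq X) :
  weak_star_cvg g f -> (forall x, x \in xs -> c < f x) ->
  \forall n \near \oo, forall x, x \in xs -> c < g n x.
Proof.
move=> gf; elim: xs => [|y xs IH] fc; first by exists 0%N.
have /IH Hxs : forall x, x \in xs -> c < f x.
  by move=> x xxs; rewrite fc// inE xxs orbT.
have Hy : \forall n \near \oo, c < g n y.
  by apply: (cvgr_gt (f y)); [exact: gf|rewrite fc// mem_head].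
apply: filterS2 Hxs Hy => n Hxs Hy x; rewrite inE => /orP[/eqP->//|].
exact: Hxs.
Qed.

(** A position of the game with r moves left is a functional in the r-th derived set that exceeds
    eps / 2 on the chosen vectors. Undoing a derivation gives g_m with g_m(x_m) eventually above eps
    / 2, while weak* convergence keeps the old inequalities. The final sum would have norm at least
    eps n / 2, against delta = eps / 4. *)
Lemma szlenk_iter_bd_space (eps : R) : 0 < eps ->
  exists n, iter n (szlenk_derived eps (@dual_ball R X)) (@dual_ball R X) = set0.
Proof.
move=> eps0; have eps4 : 0 < eps / 4 by rewrite divr_gt0.
have [n n0 Hn] := bd_tree_sum hphi b_gt0 b_lt_a a_lt1 lambda_gt1 ab_lambda
  ltr01 eps4.
exists n; apply/seteqP; split => // f0 Df0.
set D := szlenk_derived _ _ in Df0.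
have [||xs [xsn [f [Bf fxs]] xs_le]] := Hn (fun r xs =>
    exists f, iter r D (@dual_ball R X) f /\ forall x, x \in xs -> eps / 2 < f x).
- move=> r xs [f [[Bf [x [g [l [xg gf gl epsl x0]]]]] fxs]] N eta eta0.
  have Hl : \forall m \near \oo, eps / 2 < g m (x m).
    apply: (cvgr_gt l) => //; apply: lt_le_trans epsl.
    by rewrite ltr_pdivrMr// ltr_pMr// ltr1n.
  have [m [[Hx Hg] Hm]] := filter_ex (filterI (filterI
    (weakly_null_bd_coord N x0 eta0) (weak_star_cvg_gt gf fxs)) Hl).
  exists (x m); split => //; first exact: (xg m).1.
  exists (g m); split; first exact: (xg m).2.
  by move=> y; rewrite inE => /orP[/eqP->//|]; exact: Hg.
- by exists f0.
have : eps / 2 * n%:R <= f (\sum_(x <- xs) x).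
  rewrite linear_sum -xsn -sum1_size natr_sum mulr_sumr big_seq.
  rewrite [leRHS]big_seq; apply: ler_sum => x xxs; rewrite mulr1 ltW//.
  exact: fxs.
move=> /le_trans/(_ (le_trans (ler_norm _) (dual_ball_le _ Bf))).
move=> /le_trans/(_ xs_le); rewrite ler_pM2r ?ltr0n//.
by rewrite ler_pM2l// lef_pV2 ?posrE// ler_nat.
Qed.

End Szlenk.

(** * Quotients isomorphic to C(w^w) *)

(** Pigeonhole: with [-M, M] cut into cells of length eta, the first N entries fall into finitely
    many patterns of cells. *)
Lemma close_pair (R : realType) (y : nat -> nat -> R) (M eta : R) N :
  0 < eta -> (forall j i, `|y j i| <= M) ->
  exists j j', j != j' /\ forall i, (i < N)%N -> `|y j i - y j' i| <= eta.
Proof.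
move=> eta0 yM.
pose cell j i := Num.truncn ((y j i + M) / eta).
pose T := Num.truncn ((M + M) / eta).
have cell_ge0 j i : 0 <= (y j i + M) / eta.
  rewrite divr_ge0 ?(ltW eta0)// -lerBlDr sub0r.
  by have := yM j i; rewrite ler_norml => /andP[].
have cellT j i : (cell j i <= T)%N.
  have le_MM : (y j i + M) / eta <= (M + M) / eta.
    rewrite ler_pM2r ?invr_gt0// lerD2r.
    by have := yM j i; rewrite ler_norml => /andP[].
  rewrite /cell /T truncn_ge_nat; last exact: le_trans (cell_ge0 j i) le_MM.
  have /andP[+ _] := truncn_itv (cell_ge0 j i).
  by move=> /le_trans; exact.
pose f (j : 'I_(#|{ffun 'I_N -> 'I_T.+1}|.+1)) : {ffun 'I_N -> 'I_T.+1} :=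
  [ffun i : 'I_N => inord (cell j i)].
have /injectivePn[j [j' jj' fjj']] : ~~ injectiveb f.
  apply/negP => /injectiveP/leq_card.
  by rewrite card_ord ltnn.
exists (nat_of_ord j), (nat_of_ord j'); split => // i iN.
have cellE : cell j i = cell j' i.
  have /ffunP/(_ (Ordinal iN)) := fjj'; rewrite !ffunE => /(congr1 val).
  by rewrite /= !inordK// ltnS.
have /andP[l1 u1] := truncn_itv (cell_ge0 j i).
have /andP[l2 u2] := truncn_itv (cell_ge0 j' i).
move: l1 u1 l2 u2; rewrite -!/(cell _ _) cellE -natr1.
rewrite !ler_pdivlMr// !ltr_pdivrMr// mulrDl mul1r.
move: (_ * eta) => c l1 u1 l2 u2.
by rewrite ler_norml; apply/andP; split; lra.
Qed.

Section Lifting.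
Variables (R : realType) (V : normedModType R).

Fact quotient_pi_linear (Y : closedSubspace V) : linear (@quotient_pi R V Y).
Proof. by move=> k x y; rewrite quotient_piD quotient_piZ. Qed.

HB.instance Definition _ (Y : closedSubspace V) :=
  GRing.isLinear.Build R V (quotient_type Y) _ (@quotient_pi R V Y)
    (quotient_pi_linear Y).

Lemma isomorphic_to_quotient_lift (W : normedModType R) :
  isomorphic_to_quotient W V ->
  exists (S : {linear V -> W}) M, [/\ 0 < M, forall x, `|S x| <= M * `|x|
    & forall h, `|h| <= 1 -> exists2 x, S x = h & `|x| <= M].
Proof.
move=> [Y [f [g [fc gc fK gK]]]].
have [Mf Mf0 fM] := continuous_linear_bound fc.
have [Mg Mg0 gM] := continuous_linear_bound gc.
(* One constant serves both bounds; the summand 1 leaves room for a representative, as the infimum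
   in the quotient norm need not be attained. *)
exists (g \o @quotient_pi R V Y), (Mf + 1 + Mg); split.
- by rewrite !addr_gt0.
- move=> x /=; apply: (le_trans (gM _)).
  apply: (@le_trans _ _ (Mg * `|x|)).
    by rewrite ler_pM2l//; exact: quotient_norm_le.
  by rewrite ler_wpM2r// lerDr addr_ge0// ltW.
move=> h h1; have [|x xh xlt] := @quotient_norm_lt _ _ Y (f h) (Mf + 1).
  apply: le_lt_trans (fM h) _; rewrite ltr_pwDr//.
  by rewrite ler_piMr// ltW.
exists x; first by rewrite /= xh fK.
by rewrite (le_trans (ltW xlt))// lerDl ltW.
Qed.

End Lifting.

(** * Clopen intervals below w^w and their indicators *)

Section OmegaOmega.

(* The ordinal with Cantor normal form coefficients [s]; junk value w^w when
   the leading coefficient is 0. *)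
Definition cnf_ordinal (s : seq nat) : omega_omega_itv := insub s.

Lemma cnf_ordinal_le s t : head 0%N s != 0%N -> head 0%N t != 0%N ->
  (cnf_ordinal s <= cnf_ordinal t)%O = cnf_le s t.
Proof. by move=> s0 t0; rewrite /cnf_ordinal !insubT. Qed.

Lemma cnf_le_cat v s t : cnf_le (v ++ s) (v ++ t) = cnf_le s t.
Proof.
rewrite /cnf_le !size_cat ltn_add2l eqn_add2l; congr (_ || (_ && _)).
by elim: v => // x v IH /=; rewrite lexi_cons lexx IH.
Qed.

Lemma head_cat_neq0 (v s : seq nat) :
  head 0%N v != 0%N -> head 0%N (v ++ s) != 0%N.
Proof. by case: v. Qed.

Lemma cnf_lexi_succ (w t : seq nat) c : size t = (size w).+1 ->
  ((t : seqlexi nat) <= (rcons w c : seqlexi nat))%O =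
  ~~ ((rcons w c.+1 : seqlexi nat) <= (t : seqlexi nat))%O.
Proof.
elim: w t => [|x w IH] [|y t]//=.
  case: t => // _; rewrite !lexi_cons !lexi0s !implybT !andbT.
  by rewrite !leEnat leqNgt.
move=> [/IH tw]; rewrite !lexi_cons tw.
by case: ltgtP => //=; rewrite ?implybT.
Qed.

(** Adding 1 to the last coefficient gives the successor ordinal; through it the closed initial
    segment up to s is also an open ray. *)
Lemma cnf_ordinal_succ s : head 0%N s != 0%N ->
  exists be, forall t, (t <= cnf_ordinal s)%O = (t < be)%O.
Proof.
case/lastP: s => [//|w c] w0.
have w1 : head 0%N (rcons w c.+1) != 0%N by case: w w0.
exists (cnf_ordinal (rcons w c.+1)) => t; rewrite ltNge.
rewrite /cnf_ordinal !insubT; case: t => [t|//].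
rewrite /Order.le /= /cnf_le !size_rcons.
case: ltngtP => //= /eqP; rewrite ?orbF //= => /eqP.
exact: cnf_lexi_succ.
Qed.

Variable R : realType.

(** The segment and its complement are the open rays below [be] and above [al], so the indicator is
    locally constant. *)
Lemma ex_initial_indicator (al be : omega_omega_itv) :
  (forall t, (t <= al)%O = (t < be)%O) ->
  exists g : C_omega_omega R, forall t, \val (\val g) t = (t <= al)%O%:R.
Proof.
move=> albe; pose T := order_topology omega_omega_itv.
pose u : T -> R^o := fun t => (t <= al)%O%:R.
have ub : u \in @bounded_pred R T.
  by apply/bounded_predP; exists 1 => t; rewrite /u; case: (t <= al)%O; rewrite /= ?normr1 ?normr0.
have uc : continuous u.
  move=> t; apply: (@cvg_near_cst _ _ _ _ (nbhs (t : T))).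
  have [tal|alt] := leP t al.
    have : nbhs (t : T) `]-oo, (be : T)[%classic.
      by apply: open_nbhs_nbhs; split; [exact: lray_open|rewrite /= in_itv /= -albe].
    move=> nb; apply: (filterS _ nb) => s /=.
    by rewrite in_itv /= -albe /u => ->; rewrite tal.
  have : nbhs (t : T) [set` `](al : T), +oo[].
    apply: (@open_nbhs_nbhs T t); split; first exact: (@rray_open _ T al).
    by rewrite /= in_itv /= andbT.
  move=> nb; apply: (filterS _ nb) => s /=; rewrite in_itv /= andbT /u => als.
  by rewrite (ltNge al) in alt; rewrite (ltNge al) in als; rewrite (negbTE als) (negbTE alt).
have uC : (exist _ u ub : bfun R T) \in @continuous_pred R T by exact/asboolP.
by exists (exist (fun f => f \in @continuous_pred R T) _ uC : continuous_functions R T).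
Qed.

Definition cnf_block v k r : seq nat := v ++ k :: nseq r 0%N.

Lemma cnf_block_valid v k r : head 0%N v != 0%N -> head 0%N (cnf_block v k r) != 0%N.
Proof. exact: head_cat_neq0. Qed.

Lemma cnf_block_le v k l r : head 0%N v != 0%N ->
  (cnf_ordinal (cnf_block v k r) <= cnf_ordinal (cnf_block v l r))%O = (k <= l)%N.
Proof.
move=> v0; rewrite cnf_ordinal_le ?cnf_block_valid// cnf_le_cat.
rewrite /cnf_le /= size_nseq ltnn eqxx /= lexi_cons lexx implybT andbT.
by rewrite leEnat.
Qed.

(* The half-open interval (al + w^r k, al + w^r (k+1)], where al has normal
   form [v] followed by r + 1 zeros. *)
Definition cnf_itv v k r : set omega_omega_itv :=
  [set t | (cnf_ordinal (cnf_block v k r) < t)%O /\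
           (t <= cnf_ordinal (cnf_block v k.+1 r))%O].

Lemma cnf_itv_neq0 v k r : head 0%N v != 0%N -> cnf_itv v k r !=set0.
Proof.
move=> v0; exists (cnf_ordinal (cnf_block v k.+1 r)); split => //.
by rewrite ltNge cnf_block_le// ltnn.
Qed.

(** Holds because w^r (j + 1) < w^(r+1). Letting j vary gives infinitely many disjoint subintervals
    with exponent one lower, among which a move of the game chooses. *)
Lemma cnf_itv_sub v k j r : head 0%N v != 0%N ->
  cnf_itv (rcons v k) j r `<=` cnf_itv v k r.+1.
Proof.
move=> v0; have vk0 : head 0%N (rcons v k) != 0%N.
  by rewrite -cats1 head_cat_neq0.
move=> t [jt tj]; split.
  apply: le_lt_trans jt; have -> : cnf_block v k r.+1 = cnf_block (rcons v k) 0 r.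
    by rewrite /cnf_block cat_rcons.
  by rewrite cnf_block_le.
apply: le_trans tj _; rewrite cnf_ordinal_le ?cnf_block_valid//.
rewrite /cnf_block cat_rcons cnf_le_cat /cnf_le /= ltnn eqxx /=.
by rewrite lexi_cons !leEnat leqnSn ltnn.
Qed.

(** The difference of the indicators of two initial segments works. *)
Lemma ex_cnf_itv_indicator v k r : head 0%N v != 0%N ->
  exists h : C_omega_omega R, [/\ `|h| <= 1,
    forall t, cnf_itv v k r t -> \val (\val h) t = 1 &
    forall l t, l != k -> cnf_itv v l r t -> \val (\val h) t = 0].
Proof.
move=> v0.
have [b1 /ex_initial_indicator[g1 g1E]] := cnf_ordinal_succ (cnf_block_valid k.+1 r v0).
have [b0 /ex_initial_indicator[g0 g0E]] := cnf_ordinal_succ (cnf_block_valid k r v0).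
have hE t : \val (\val (g1 - g0)) t =
    (t <= cnf_ordinal (cnf_block v k.+1 r))%O%:R -
    (t <= cnf_ordinal (cnf_block v k r))%O%:R.
  by rewrite !raddfB /= -g1E -g0E.
exists (g1 - g0); split.
- apply: (@bfun_norm_le _ _ (\val (g1 - g0))) => // t; rewrite hE.
  do 2 case: (t <= _)%O;
    by rewrite /= ?subrr ?subr0 ?sub0r ?normrN ?normr0 ?normr1.
- by move=> t [kt tk]; rewrite hE tk leNgt kt subr0.
move=> l t lk [lt tl]; rewrite hE; apply/eqP; rewrite subr_eq0; apply/eqP.
have [{}lk|kl|lk0] := ltngtP l k; last by rewrite lk0 eqxx in lk.
  by rewrite !(le_trans tl)// cnf_block_le// ltnW.
rewrite !leNgt !(le_lt_trans _ lt)// cnf_block_le//; exact: ltnW.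
Qed.

End OmegaOmega.

Section Quotients.
Variables (R : realType) (a b lambda : R) (d : nat -> nat) (phi : nat -> bd_tuple).
Hypotheses (hphi : bd_enumeration d phi) (b_gt0 : 0 < b) (b_lt_a : b < a)
  (a_lt1 : a < 1) (lambda_gt1 : 1 < lambda)
  (ab_lambda : a + 2 * b * lambda < lambda).

Local Notation X := (bd_space a b d phi).

Lemma C_omega_omega_not_quotient : ~ isomorphic_to_quotient (C_omega_omega R) X.
Proof.
move=> /isomorphic_to_quotient_lift[S [M [M0 SM lift]]].
(* A move is a difference of two lifts, hence the bound 2 M; delta = 1 / (2 M) forces the image of
   the sum to have norm at most n / 2. *)
have [n n0 Hn] := bd_tree_sum hphi b_gt0 b_lt_a a_lt1 lambda_gt1 ab_lambda
  (mulr_gt0 (ltr0n R 2) M0) (divr_gt0 ltr01 (mulr_gt0 (ltr0n R 2) M0)).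
have [||xs [xsn [v [k [v0 Sxs]]] xs_le]] := Hn (fun r xs => exists v k,
    head 0%N v != 0%N /\ forall t, cnf_itv v k r t ->
      forall x, x \in xs -> \val (\val (S x)) t = 1).
- move=> r xs [v [k [v0 Sxs]]] N eta eta0.
  have vk0 : head 0%N (rcons v k) != 0%N by rewrite -cats1 head_cat_neq0.
  have /choice[y yP] : forall j, exists x : X, [/\ `|x| <= M,
      forall t, cnf_itv (rcons v k) j r t -> \val (\val (S x)) t = 1 &
      forall l t, l != j -> cnf_itv (rcons v k) l r t -> \val (\val (S x)) t = 0].
    move=> j; have [h [h1 hj hl]] := ex_cnf_itv_indicator R j r vk0.
    by have [x xh xM] := lift h h1; exists x; rewrite xh.
  have [|i [j [ij yij]]] := @close_pair R (fun j l => bd_coord l (y j)) M eta N eta0.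
    by move=> j l; apply: le_trans (bd_coord_norm _ _) _; have [] := yP j.
  have [yiM yi1 _] := yP i; have [yjM _ yj0] := yP j.
  exists (y i - y j); split.
  + by rewrite mulr_natl mulr2n (le_trans (ler_normB _ _))// lerD.
  + by move=> l lN; rewrite raddfB; exact: yij.
  (* The interval of index i is kept: there [S (y i)] is 1 and [S (y j)] is 0, and the earlier
     images stay 1 since it lies in the previous interval. *)
  exists (rcons v k), i; split => // t ti x; rewrite inE => /orP[/eqP->|xxs].
    rewrite !raddfB /= -[RHS]subr0 -(yi1 t ti) -(yj0 i t ij ti).
    by [].
  by apply: Sxs xxs; exact: cnf_itv_sub ti.
(* The game starts on (w^(n+1), w^(n+1) + w^n], which leaves room for n moves; such an interval lies
   below w^w for every n. *)
- by exists [:: 1%N], 0%N.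
have [t tv] := cnf_itv_neq0 k 0 v0.
have St : \val (\val (S (\sum_(x <- xs) x))) t = n%:R.
  rewrite -xsn -sum1_size natr_sum.
  have : forall x, x \in xs -> \val (\val (S x)) t = 1 by move=> x; exact: Sxs.
  elim: (xs) => [|x zs IH] H; first by rewrite !big_nil !raddf0.
  rewrite !big_cons -IH => [|z zzs]; last by rewrite H// inE zzs orbT.
  by rewrite -[1](H x (mem_head _ _)) !raddfD.
have : n%:R <= M * (1 / (2 * M) * n%:R).
  apply: le_trans (ler_wpM2l (ltW M0) xs_le).
  apply: le_trans (SM _); rewrite -[n%:R]ger0_norm// -St.
  exact: (bfun_norm_ge (\val (S _))).
rewrite mulrA -{1}[n%:R]mul1r ler_pM2r ?ltr0n//.
by rewrite mul1r invfM mulrCA mulfV ?lt0r_neq0// mulr1 invf_ge1// lern1.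
Qed.

End Quotients.

Theorem corollary4p4 (R : realType) (a b lambda : R)
    (b_gt0 : 0 < b) (b_lt_a : b < a) (a_lt1 : a < 1) (lambda_gt1 : 1 < lambda)
    (ab_lambda : a + 2 * b * lambda < lambda)
    (d : nat -> nat) (phi : nat -> bd_tuple) (hphi : bd_enumeration d phi) :
  (forall eps : R, 0 < eps ->
     lt_omega (szlenk_eta eps (@dual_ball R (bd_space a b d phi)))) /\
  ~ isomorphic_to_quotient (C_omega_omega R) (bd_space a b d phi).
Proof.
split; last exact: C_omega_omega_not_quotient ab_lambda.
move=> eps eps0.
have [n] := szlenk_iter_bd_space hphi b_gt0 b_lt_a a_lt1 lambda_gt1 ab_lambda eps0.
exact: szlenk_eta_lt_omega.
Qed.
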